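(* Let $\eta,\eta'\in\{0,1\}$. If $\vdash_\eta P$ and $\langle\eta;P\rangle\xrightarrow{\mu}\langle\eta';P'\rangle$, then $\vdash_{\eta'}P'$.
   Context: Asynchronous $\pi$-calculus: processes $P ::= a\langle\tilde b\rangle \mid\ !a(\tilde b).P \mid P|Q \mid (\nu a)P \mid G$, $G ::= \mathbf 0 \mid a(\tilde b).P \mid \tau.P \mid [a=b]G \mid G+G'$, well-sorted under a fixed sorting; $P\xrightarrow{\mu}P'$ is the standard early LTS of the asynchronous $\pi$-calculus with actions $\tau$, early inputs $a(\tilde b)$ and outputs $(\nu\tilde c)a\langle\tilde b\rangle$ (subject $a$). Names are partitioned into output-controlled ($x,y,z$) and input-controlled ($u,v,w$). Judgements $\vdash_\eta P$, $\eta\in\{0,1\}$: $\vdash_1 u(\tilde a).P$ if $\vdash_1P$; $\vdash_0 x(\tilde a).P$, $\vdash_0 !x(\tilde a).P$ if $\vdash_1P$; $\vdash_1x\langle\tilde a\rangle$; $\vdash_0u\langle\tilde a\rangle$; $\vdash_\eta(\nu a)P$ if $\vdash_\eta P$; $\vdash_0\mathbf0$; $\vdash_{\eta_1+\eta_2}P|Q$ if $\vdash_{\eta_1}P$, $\vdash_{\eta_2}Q$, $\eta_1+\eta_2\le1$; $\vdash_\eta G_1+G_2$ if $\vdash_\eta G_1,G_2$; $\vdash_\eta\tau.P$ if $\vdash_\eta P$; $\vdash_0[a=b]G$ if $\vdash_0G$. A type-allowed transition $\eta\vdash P\xrightarrow{\mu}P'$ holds if $\vdash_\eta P$, $P\xrightarrow{\mu}P'$,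 and $\eta=0$, or $\mu=\tau$, or $\eta=1$ and $\mu$ is an input at an input-controlled name or an output at an output-controlled name. $\langle\eta;P\rangle\xrightarrow{\mu}\langle\eta';P'\rangle$ holds if $\eta\vdash P\xrightarrow{\mu}P'$ and $\eta'=1$ when $\mu$ is an input at an output-controlled name, $\eta'=0$ when $\mu$ is an output at an output-controlled name, and $\eta'=\eta$ otherwise. *)

(* Defs.v *)
From mathcomp Require Import all_boot.

Set Implicit Arguments.
Unset Strict Implicit.
Unset Printing Implicit Defensive.

Section Syntax.

Variable S : eqType.

(* A name carries its sort, and there are countably many names of each sort. *)
Definition name : Type := (S * nat)%type.

Definition nsort (a : name) : S := a.1.

Inductive proc : Type :=
  | Out of name & seq name
  | Rep of name & seq name & proc
  | Par of proc & proc
  | Res of name & proc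
  | Sum of guard
with guard : Type :=
  | Nil
  | In of name & seq name & proc
  | Tau of proc
  | Match of name & name & guard
  | Choice of guard & guard.

Definition Ress (cs : seq name) (P : proc) : proc := foldr Res P cs.

Fixpoint fn (P : proc) : seq name :=
  match P with
  | Out a bs => a :: bs
  | Rep a bs P => a :: [seq c <- fn P | c \notin bs]
  | Par P Q => fn P ++ fn Q
  | Res a P => [seq c <- fn P | c != a]
  | Sum G => fng G
  end
with fng (G : guard) : seq name :=
  match G with
  | Nil => [::]
  | In a bs P => a :: [seq c <- fn P | c \notin bs]
  | Tau P => fn P
  | Match a b G => a :: b :: fng G
  | Choice G1 G2 => fng G1 ++ fng G2
  end.

Definition above (avoid : seq name) : nat := (\max_(c <- avoid) c.2).+1.

Definition shift (m : nat) (b : name) : name := (b.1, m + b.2).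

(* Capture-avoiding simultaneous substitution.  Going under the binders bs,
   each of them is renamed to a name of the same sort whose index exceeds those
   of all the names that must not be captured; shift is injective, so distinct
   binders remain distinct. *)
Definition under (s : name -> name) (bs : seq name) (m : nat) (x : name) :=
  if x \in bs then shift m x else s x.

Definition avoiding (s : name -> name) (bs : seq name) (P : proc) : nat :=
  above [seq s c | c <- fn P & c \notin bs].

Fixpoint subst (s : name -> name) (P : proc) : proc :=
  match P with
  | Out a bs => Out (s a) (map s bs)
  | Rep a bs P => let m := avoiding s bs P in
      Rep (s a) (map (shift m) bs) (subst (under s bs m) P)
  | Par P Q => Par (subst s P) (subst s Q)
  | Res a P => let m := avoiding s [:: a] P in
      Res (shift m a) (subst (under s [:: a] m) P)
  | Sum G => Sum (substg s G)
  end
with substg (s : name -> name) (G : guard) : guard :=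
  match G with
  | Nil => Nil
  | In a bs P => let m := avoiding s bs P in
      In (s a) (map (shift m) bs) (subst (under s bs m) P)
  | Tau P => Tau (subst s P)
  | Match a b G => Match (s a) (s b) (substg s G)
  | Choice G1 G2 => Choice (substg s G1) (substg s G2)
  end.

(* The substitution {cs/bs}, for bs and cs of the same length; names outside bs
   are left unchanged. *)
Definition repl (bs cs : seq name) (x : name) : name := nth x cs (index x bs).

Definition disjoint_names (s t : seq name) : bool := ~~ has [in t] s.

(* cs may replace bs as the binders of a prefix with continuation P. *)
Definition renames (bs cs : seq name) (P : proc) : Prop :=
  [/\ uniq bs, uniq cs, map nsort cs = map nsort bs
    & disjoint_names cs [seq c <- fn P | c \notin bs]].

Inductive alpha : proc -> proc -> Prop :=
  | alpha_refl P : alpha P P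
  | alpha_sym P Q : alpha P Q -> alpha Q P
  | alpha_trans P Q R : alpha P Q -> alpha Q R -> alpha P R
  | alpha_rep a bs P P' : alpha P P' -> alpha (Rep a bs P) (Rep a bs P')
  | alpha_par P P' Q Q' :
      alpha P P' -> alpha Q Q' -> alpha (Par P Q) (Par P' Q')
  | alpha_res a P P' : alpha P P' -> alpha (Res a P) (Res a P')
  | alpha_in a bs P P' :
      alpha P P' -> alpha (Sum (In a bs P)) (Sum (In a bs P'))
  | alpha_tau P P' : alpha P P' -> alpha (Sum (Tau P)) (Sum (Tau P'))
  | alpha_match a b G G' :
      alpha (Sum G) (Sum G') -> alpha (Sum (Match a b G)) (Sum (Match a b G'))
  | alpha_choice G1 G1' G2 G2' :
      alpha (Sum G1) (Sum G1') -> alpha (Sum G2) (Sum G2') ->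
      alpha (Sum (Choice G1 G2)) (Sum (Choice G1' G2'))
  | alpha_rename_rep a bs cs P : renames bs cs P ->
      alpha (Rep a bs P) (Rep a cs (subst (repl bs cs) P))
  | alpha_rename_in a bs cs P : renames bs cs P ->
      alpha (Sum (In a bs P)) (Sum (In a cs (subst (repl bs cs) P)))
  | alpha_rename_res a b P : renames [:: a] [:: b] P ->
      alpha (Res a P) (Res b (subst (repl [:: a] [:: b]) P)).

(* AOut cs a bs is the output (nu cs) a<bs>. *)
Inductive action : Type :=
  | ATau
  | AIn of name & seq name
  | AOut of seq name & name & seq name.

Definition bn (mu : action) : seq name :=
  if mu is AOut cs _ _ then cs else [::].

Definition an (mu : action) : seq name :=
  match mu with
  | ATau => [::]
  | AIn a bs => a :: bs
  | AOut cs a bs => a :: cs ++ bs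
  end.

Section Sorting.

(* Names of sort T carry tuples of names of sorts ob T. *)
Variable ob : S -> seq S.

Definition carries (a : name) (bs : seq name) : Prop :=
  map nsort bs = ob (nsort a).

Fixpoint well_sorted (P : proc) : Prop :=
  match P with
  | Out a bs => carries a bs
  | Rep a bs P => [/\ uniq bs, carries a bs & well_sorted P]
  | Par P Q => well_sorted P /\ well_sorted Q
  | Res _ P => well_sorted P
  | Sum G => well_sortedg G
  end
with well_sortedg (G : guard) : Prop :=
  match G with
  | Nil => True
  | In a bs P => [/\ uniq bs, carries a bs & well_sorted P]
  | Tau P => well_sorted P
  | Match _ _ G => well_sortedg G
  | Choice G1 G2 => well_sortedg G1 /\ well_sortedg G2
  end.

(* Early transitions, on processes up to alpha-conversion.  The names received
   in an input are of the sorts prescribed by the sorting. *)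
Inductive lts : proc -> action -> proc -> Prop :=
  | lts_in a bs cs P : carries a cs ->
      lts (Sum (In a bs P)) (AIn a cs) (subst (repl bs cs) P)
  | lts_rep a bs cs P : carries a cs ->
      lts (Rep a bs P) (AIn a cs) (Par (subst (repl bs cs) P) (Rep a bs P))
  | lts_out a bs : lts (Out a bs) (AOut [::] a bs) (Sum Nil)
  | lts_tau P : lts (Sum (Tau P)) ATau P
  | lts_match a G mu P' :
      lts (Sum G) mu P' -> lts (Sum (Match a a G)) mu P'
  | lts_choicel G1 G2 mu P' :
      lts (Sum G1) mu P' -> lts (Sum (Choice G1 G2)) mu P'
  | lts_choicer G1 G2 mu P' :
      lts (Sum G2) mu P' -> lts (Sum (Choice G1 G2)) mu P'
  | lts_parl P Q mu P' : lts P mu P' -> disjoint_names (bn mu) (fn Q) ->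
      lts (Par P Q) mu (Par P' Q)
  | lts_parr P Q mu Q' : lts Q mu Q' -> disjoint_names (bn mu) (fn P) ->
      lts (Par P Q) mu (Par P Q')
  | lts_comml P Q cs a bs P' Q' :
      lts P (AOut cs a bs) P' -> lts Q (AIn a bs) Q' ->
      disjoint_names cs (fn Q) ->
      lts (Par P Q) ATau (Ress cs (Par P' Q'))
  | lts_commr P Q cs a bs P' Q' :
      lts P (AIn a bs) P' -> lts Q (AOut cs a bs) Q' ->
      disjoint_names cs (fn P) ->
      lts (Par P Q) ATau (Ress cs (Par P' Q'))
  | lts_res a P mu P' : lts P mu P' -> a \notin an mu ->
      lts (Res a P) mu (Res a P')
  | lts_open d P cs a bs P' :
      lts P (AOut cs a bs) P' -> d \in bs -> d \notin a :: cs ->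
      lts (Res d P) (AOut (d :: cs) a bs) P'
  | lts_alpha P Q mu Q' P' :
      alpha P Q -> lts Q mu Q' -> alpha Q' P' -> lts P mu P'.

(* All names of a given sort are controlled in the same way. *)
Variant control : Type := OutputControlled | InputControlled.

Variable ctl : S -> control.

Definition ocontrolled (a : name) : Prop := ctl (nsort a) = OutputControlled.
Definition icontrolled (a : name) : Prop := ctl (nsort a) = InputControlled.

Inductive typed : nat -> proc -> Prop :=
  | typed_in_i u bs P :
      icontrolled u -> typed 1 P -> typed 1 (Sum (In u bs P))
  | typed_in_o x bs P :
      ocontrolled x -> typed 1 P -> typed 0 (Sum (In x bs P))
  | typed_rep x bs P :
      ocontrolled x -> typed 1 P -> typed 0 (Rep x bs P)
  | typed_out_o x bs : ocontrolled x -> typed 1 (Out x bs)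
  | typed_out_i u bs : icontrolled u -> typed 0 (Out u bs)
  | typed_res eta a P : typed eta P -> typed eta (Res a P)
  | typed_nil : typed 0 (Sum Nil)
  | typed_par eta1 eta2 P Q :
      typed eta1 P -> typed eta2 Q -> eta1 + eta2 <= 1 ->
      typed (eta1 + eta2) (Par P Q)
  | typed_choice eta G1 G2 :
      typed eta (Sum G1) -> typed eta (Sum G2) ->
      typed eta (Sum (Choice G1 G2))
  | typed_tau eta P : typed eta P -> typed eta (Sum (Tau P))
  | typed_match a b G : typed 0 (Sum G) -> typed 0 (Sum (Match a b G)).

Definition active_action (mu : action) : Prop :=
  match mu with
  | ATau => False
  | AIn a _ => icontrolled a
  | AOut _ a _ => ocontrolled a
  end.

Definition allowed (eta : nat) (P : proc) (mu : action) (P' : proc) : Prop :=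
  [/\ typed eta P, lts P mu P'
    & [\/ eta = 0, mu = ATau | eta = 1 /\ active_action mu]].

Definition next_eta (eta : nat) (mu : action) : nat :=
  match mu with
  | ATau => eta
  | AIn a _ => if ctl (nsort a) is OutputControlled then 1 else eta
  | AOut _ a _ => if ctl (nsort a) is OutputControlled then 0 else eta
  end.

(* <eta; P> --mu--> <eta'; P'> *)
Definition cstep (eta : nat) (P : proc) (mu : action) (eta' : nat) (P' : proc)
    : Prop :=
  allowed eta P mu P' /\ eta' = next_eta eta mu.

End Sorting.

End Syntax.

Arguments Nil {S}.
Arguments ATau {S}.

(* Main.v *)
Require Import Defs.
From mathcomp Require Import all_boot.

(** Typing depends on names only through their sorts, so it is invariant under
    sort-preserving substitution and hence under alpha-conversion; on
    well-sorted processes every substitution performed by an input is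
    sort-preserving.  The induction on transitions needs, beyond subject
    reduction, that an input at an input-controlled name or an output at an
    output-controlled name forces [eta = 1]: this excludes the transitions that
    are not type-allowed and fixes how [eta] splits between two communicating
    components. *)

Set Implicit Arguments.
Unset Strict Implicit.
Unset Printing Implicit Defensive.

Scheme proc_guard_ind := Induction for proc Sort Prop
  with guard_proc_ind := Induction for guard Sort Prop.
Combined Scheme proc_guard_mutind from proc_guard_ind, guard_proc_ind.

Section SubjectReduction.

Variables (S : eqType) (ob : S -> seq S) (ctl : S -> control).
Implicit Types (P Q : proc S) (G : guard S) (s : name S -> name S).

(** * Sort-preserving substitutions *)

Definition sort_preserving s := forall x, nsort (s x) = nsort x.

Lemma under_sort_preserving s bs m :
  sort_preserving s -> sort_preserving (under s bs m).
Proof. by move=> hs x; rewrite /under; case: ifP => // _; apply: hs. Qed.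

Lemma repl_sort_preserving (bs cs : seq (name S)) :
  map (@nsort S) cs = map (@nsort S) bs -> sort_preserving (repl bs cs).
Proof.
move=> eq_sorts x; rewrite /repl.
have eq_size : size cs = size bs by have := congr1 size eq_sorts; rewrite !size_map.
have [xbs|xbs] := boolP (x \in bs); last first.
  (* A name outside [bs] has index [size bs], which is also [size cs], so [nth] returns its default
     [x]. *)
  by rewrite nth_default // eq_size memNindex.
have lt_x : index x bs < size bs by rewrite index_mem.
rewrite -(nth_map x (nsort x) (@nsort S)) ?eq_size // eq_sorts.
by rewrite (nth_map x) // nth_index.
Qed.

(** * Well-sortedness under substitution and alpha-conversion *)

Lemma carries_sort_preserving s (a : name S) bs :
  sort_preserving s -> carries ob (s a) bs <-> carries ob a bs.
Proof. by move=> hs; rewrite /carries hs. Qed.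

Lemma carries_map_sort_preserving s (a : name S) bs :
  sort_preserving s -> carries ob a (map s bs) <-> carries ob a bs.
Proof. by move=> hs; rewrite /carries -map_comp (eq_map hs). Qed.

Lemma shift_inj m : injective (@shift S m).
Proof. by move=> [a i] [b j] [-> /addnI ->]. Qed.

Lemma well_sorted_binders s m (a : name S) bs : sort_preserving s ->
  uniq (map (shift m) bs) /\ carries ob (s a) (map (shift m) bs) <->
  uniq bs /\ carries ob a bs.
Proof.
move=> hs; rewrite (map_inj_uniq (@shift_inj m)).
have hm : sort_preserving (shift m) by [].
have h1 := carries_sort_preserving a (map (shift m) bs) hs.
have h2 := carries_map_sort_preserving a bs hm.
by tauto.
Qed.

(** The substitution changes under each binder, so [s] is quantified inside the induction. An
    equivalence is proved because [alpha] is symmetric: renaming has to preserve well-sortedness in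
    both directions. *)
Lemma well_sorted_subst_mut :
  (forall P s, sort_preserving s ->
     well_sorted ob (subst s P) <-> well_sorted ob P) /\
  (forall G s, sort_preserving s ->
     well_sortedg ob (substg s G) <-> well_sortedg ob G).
Proof.
apply: proc_guard_mutind => /=.
- move=> a bs s hs.
  have h1 := carries_sort_preserving a (map s bs) hs.
  have h2 := carries_map_sort_preserving a bs hs.
  by tauto.
- move=> a bs P IH s hs; set m := avoiding _ _ _.
  have h1 := IH _ (under_sort_preserving bs m hs).
  have h2 := well_sorted_binders m a bs hs.
  by split=> -[? ? ?]; split; tauto.
- by move=> P IHP Q IHQ s hs; have := IHP _ hs; have := IHQ _ hs; tauto.
- by move=> a P IH s hs; apply: IH; apply: under_sort_preserving.
- by [].
- by [].
- move=> a bs P IH s hs; set m := avoiding _ _ _.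
  have h1 := IH _ (under_sort_preserving bs m hs).
  have h2 := well_sorted_binders m a bs hs.
  by split=> -[? ? ?]; split; tauto.
- by [].
- by [].
- by move=> P IHP Q IHQ s hs; have := IHP _ hs; have := IHQ _ hs; tauto.
Qed.

Lemma well_sorted_subst s P : sort_preserving s ->
  well_sorted ob (subst s P) <-> well_sorted ob P.
Proof. by move=> hs; apply: (proj1 well_sorted_subst_mut). Qed.

Lemma well_sorted_renamed (a : name S) bs cs P : renames bs cs P ->
  [/\ uniq bs, carries ob a bs & well_sorted ob P] <->
  [/\ uniq cs, carries ob a cs & well_sorted ob (subst (repl bs cs) P)].
Proof.
case=> -> -> eq_sorts _; rewrite /carries eq_sorts.
have h := well_sorted_subst P (repl_sort_preserving eq_sorts).
by split=> -[? ? ?]; split; tauto.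
Qed.

Lemma well_sorted_alpha P Q :
  alpha P Q -> well_sorted ob P <-> well_sorted ob Q.
Proof.
elim=> //=.
- by move=> *; tauto.
- by move=> *; tauto.
- by move=> a bs P1 P2 _ h; split=> -[? ? ?]; split; tauto.
- by move=> *; tauto.
- by move=> a bs P1 P2 _ h; split=> -[? ? ?]; split; tauto.
- by move=> *; tauto.
- by move=> a bs cs P1 /well_sorted_renamed.
- by move=> a bs cs P1 /well_sorted_renamed.
- move=> a b P1 [_ _ /repl_sort_preserving h _].
  by have := well_sorted_subst P1 h; tauto.
Qed.

(** * Typing under substitution and alpha-conversion *)

Lemma typed_subst_mut :
  (forall P s eta, sort_preserving s ->
     typed ctl eta (subst s P) <-> typed ctl eta P) /\
  (forall G s eta, sort_preserving s ->
     typed ctl eta (Sum (substg s G)) <-> typed ctl eta (Sum G)).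
Proof.
have hi s a : sort_preserving s -> icontrolled ctl (s a) <-> icontrolled ctl a.
  by move=> hs; rewrite /icontrolled hs.
have ho s a : sort_preserving s -> ocontrolled ctl (s a) <-> ocontrolled ctl a.
  by move=> hs; rewrite /ocontrolled hs.
apply: proc_guard_mutind => /=.
- by move=> a bs s eta hs; split=> h; inversion h; subst; constructor;
    apply/(hi s a hs) || apply/(ho s a hs).
- move=> a bs P IH s eta hs.
  (* The continuation of a replication is typed at 1 while the replication itself is typed at 0, so
     the hypothesis is kept open in the index [e]; [m] stands for the freshness bound. *)
  have h1 m e := IH _ e (under_sort_preserving bs m hs).
  by split=> h; inversion h; subst; constructor;
    first [exact/(ho s a hs) | apply/h1; eassumption].
- by move=> P IHP Q IHQ s eta hs; split=> h; inversion h; subst;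
    constructor=> //; first [exact/(IHP s _ hs) | exact/(IHQ s _ hs)].
- move=> a P IH s eta hs.
  have h1 m := IH _ eta (under_sort_preserving [:: a] m hs).
  by split=> h; inversion h; subst; constructor; apply/h1; eassumption.
- by [].
- by [].
- move=> a bs P IH s eta hs.
  have h1 m e := IH _ e (under_sort_preserving bs m hs).
  by split=> h; inversion h; subst; constructor;
    first [exact/(hi s a hs) | exact/(ho s a hs) | apply/h1; eassumption].
- by move=> P IH s eta hs; split=> h; inversion h; subst; constructor;
    exact/(IH s _ hs).
- by move=> a b G IH s eta hs; split=> h; inversion h; subst; constructor;
    exact/(IH s _ hs).
- by move=> G1 IH1 G2 IH2 s eta hs; split=> h; inversion h; subst;
    constructor; first [exact/(IH1 s _ hs) | exact/(IH2 s _ hs)].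
Qed.

Lemma typed_subst s eta P : sort_preserving s ->
  typed ctl eta (subst s P) <-> typed ctl eta P.
Proof. by move=> hs; apply: (proj1 typed_subst_mut). Qed.

Lemma typed_alpha P Q :
  alpha P Q -> forall eta, typed ctl eta P <-> typed ctl eta Q.
Proof.
elim=> {P Q}.
- by [].
- by move=> P Q _ IH eta; have := IH eta; tauto.
- by move=> P Q R _ IH1 _ IH2 eta; have := IH1 eta; have := IH2 eta; tauto.
- by move=> a bs P P' _ IH eta; split=> h; inversion h; subst; constructor=> //;
    apply/IH.
- by move=> P P' Q Q' _ IHP _ IHQ eta; split=> h; inversion h; subst;
    constructor=> //; first [exact/IHP | exact/IHQ].
- by move=> a P P' _ IH eta; split=> h; inversion h; subst; constructor; apply/IH.
- by move=> a bs P P' _ IH eta; split=> h; inversion h; subst; constructor=> //;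
    apply/IH.
- by move=> P P' _ IH eta; split=> h; inversion h; subst; constructor; apply/IH.
- by move=> a b G G' _ IH eta; split=> h; inversion h; subst; constructor;
    apply/IH.
- by move=> G1 G1' G2 G2' _ IH1 _ IH2 eta; split=> h; inversion h; subst;
    constructor; first [exact/IH1 | exact/IH2].
- move=> a bs cs P [_ _ /repl_sort_preserving hs _] eta.
  by split=> h; inversion h; subst; constructor=> //;
    apply/(typed_subst _ _ hs); eassumption.
- move=> a bs cs P [_ _ /repl_sort_preserving hs _] eta.
  by split=> h; inversion h; subst; constructor=> //;
    apply/(typed_subst _ _ hs); eassumption.
- move=> a b P [_ _ /repl_sort_preserving hs _] eta.
  by split=> h; inversion h; subst; constructor=> //;
    apply/(typed_subst _ _ hs); eassumption.
Qed.

(** * Typing of the residuals of transitions *)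

Lemma typed_Ress eta (cs : seq (name S)) P :
  typed ctl eta P -> typed ctl eta (Ress cs P).
Proof. by move=> h; elim: cs => //= c cs; apply: typed_res. Qed.

(** The induction invariant, stated for all transitions instead of the type-allowed ones. The two
    conjunctions record the actions that force [eta = 1]; an input at an output-controlled name is
    constrained only when [eta = 0]. *)
Definition residual_typed (eta : nat) (mu : action S) (P' : proc S) : Prop :=
  match mu with
  | ATau => typed ctl eta P'
  | AIn a _ => if ctl (nsort a) is OutputControlled
               then eta = 0 -> typed ctl 1 P'
               else eta = 1 /\ typed ctl 1 P'
  | AOut _ a _ => if ctl (nsort a) is OutputControlled
                  then eta = 1 /\ typed ctl 0 P'
                  else typed ctl eta P'
  end.

(** Typing of the residual occurs only positively in [residual_typed], so component swaps,
    restriction and alpha-conversion carry over. *)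
Lemma residual_typed_homo eta mu P P' :
  (forall e, typed ctl e P -> typed ctl e P') ->
  residual_typed eta mu P -> residual_typed eta mu P'.
Proof.
move=> h; case: mu => [|a bs|cs a bs] /=; first exact: h.
  by case: (ctl _) => [hP e0|[e1 hP]]; [apply/h/hP|split=> //; apply: h].
by case: (ctl _) => [[e1 hP]|]; [split=> //; apply: h|apply: h].
Qed.

(** An action forcing [eta1 = 1] leaves [eta2 = 0] by the bound on the sum. For an input at an
    output-controlled name, a total of 0 makes both indices 0, and the residual is typed at 1 +
    0. *)
Lemma residual_typed_parl eta1 eta2 mu P' Q :
  typed ctl eta2 Q -> eta1 + eta2 <= 1 ->
  residual_typed eta1 mu P' -> residual_typed (eta1 + eta2) mu (Par P' Q).
Proof.
move=> hQ le1; case: mu => [|a bs|cs a bs] /=.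
- by move=> hP; constructor.
- case: (ctl _) => [hP /eqP|[e1 hP]].
    rewrite addn_eq0 => /andP[/eqP e1 /eqP e2]; subst.
    exact: (typed_par (hP erefl) hQ).
  by subst; case: eta2 hQ le1 => // hQ _; split=> //; apply: (typed_par hP hQ).
- case: (ctl _) => [[e1 hP]|hP]; last by constructor.
  by subst; case: eta2 hQ le1 => // hQ _; split=> //; apply: (typed_par hP hQ).
Qed.

Lemma residual_typed_parr eta1 eta2 mu P Q' :
  typed ctl eta1 P -> eta1 + eta2 <= 1 ->
  residual_typed eta2 mu Q' -> residual_typed (eta1 + eta2) mu (Par P Q').
Proof.
rewrite addnC => hP le1 hQ.
apply: residual_typed_homo (residual_typed_parl hP le1 hQ) => e h.
by inversion h; subst; rewrite addnC; constructor=> //; rewrite addnC.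
Qed.

(** At an output-controlled name the sender has index 1 and the receiver 0, and the communication
    exchanges these values. At an input-controlled name the receiver has index 1 and both indices
    stay as they are. The sum is preserved either way. *)
Lemma residual_typed_comm eta1 eta2 cs (a : name S) bs P' Q' :
  eta1 + eta2 <= 1 ->
  residual_typed eta1 (AOut cs a bs) P' -> residual_typed eta2 (AIn a bs) Q' ->
  typed ctl (eta1 + eta2) (Par P' Q').
Proof.
move=> le1 /=; case: (ctl _) => [[e1 hP] hQ|hP [e2 hQ]]; subst.
  by case: eta2 le1 hQ => // _ /(_ erefl) hQ; apply: (typed_par hP hQ).
exact: typed_par.
Qed.

Lemma lts_residual_typed P mu P' : lts ob P mu P' ->
  forall eta, well_sorted ob P -> typed ctl eta P -> residual_typed eta mu P'.
Proof.
elim=> {P mu P'}.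
- move=> a bs cs P ca eta /= [_ cb _] h; rewrite /carries -cb in ca.
  (* The binders and the received names both have the sorts that [ob] assigns to the subject [a], so
     the substitution is sort-preserving. *)
  have hs := typed_subst 1 P (repl_sort_preserving ca).
  by inversion h as [u bs' P' hu hP|x bs' P' hx hP| | | | | | | | |]; subst;
    rewrite ?hu ?hx; [split=> // | move=> _]; apply/hs.
- move=> a bs cs P ca eta /= [_ cb _] h; rewrite /carries -cb in ca.
  have hs := typed_subst 1 P (repl_sort_preserving ca).
  inversion h as [| |x bs' P' hx hP| | | | | | | |]; subst; rewrite hx => _.
  (* The spawned continuation accounts for the 1, the persisting replication for the 0. *)
  by apply: (typed_par (eta1 := 1) (eta2 := 0)) => //; apply/hs.
- move=> a bs eta /= _ h.
  by inversion h as [| | |x bs' hx|u bs' hu| | | | | |]; subst;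
    rewrite ?hx ?hu; [split=> // |]; apply: typed_nil.
- by move=> P eta /= _ h; inversion h.
- by move=> a G mu P' _ IH eta /= ws h; inversion h; subst; apply: IH.
- by move=> G1 G2 mu P' _ IH eta /= [ws _] h; inversion h; subst; apply: IH.
- by move=> G1 G2 mu P' _ IH eta /= [_ ws] h; inversion h; subst; apply: IH.
- move=> P Q mu P' _ IH _ eta /= [ws _] h; inversion h; subst.
  by apply: residual_typed_parl => //; apply: IH.
- move=> P Q mu Q' _ IH _ eta /= [_ ws] h; inversion h; subst.
  by apply: residual_typed_parr => //; apply: IH.
- move=> P Q cs a bs P' Q' _ IHP _ IHQ _ eta [wsP wsQ] h.
  inversion h; subst; apply: typed_Ress.
  by apply: residual_typed_comm (IHP _ wsP _) (IHQ _ wsQ _).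
- move=> P Q cs a bs P' Q' _ IHP _ IHQ _ eta [wsP wsQ] h.
  inversion h as [| | | | | | |eta1 eta2 P0 Q0 hP hQ le1| | |]; subst.
  apply: typed_Ress; rewrite addnC in le1.
  have h' := residual_typed_comm le1 (IHQ _ wsQ hQ) (IHP _ wsP hP).
  (* The communication may have moved the 1 to the other component, so the split [e1], [e2] is read
     off [h']; only its sum is known. *)
  by inversion h' as [| | | | | | |e1 e2 P1 Q1 hQ' hP' le1' eqe| | |]; subst;
    rewrite addnC -eqe addnC; constructor=> //; rewrite addnC.
- move=> a P mu P' _ IH _ eta /= ws h; inversion h; subst.
  by apply: residual_typed_homo (IH _ ws _) => // e; apply: typed_res.
(* [residual_typed] ignores the extruded names of an output, so the induction hypothesis is already
   the goal. *)
- by move=> d P cs a bs P' _ IH _ _ eta /= ws h; inversion h; subst; apply: IH.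
- move=> P Q mu Q' P' hPQ _ IH hQP eta ws h.
  apply: residual_typed_homo (IH _ _ _) => [e||].
  + by move/(typed_alpha hQP).
  + exact/(well_sorted_alpha hPQ).
  + exact/(typed_alpha hPQ).
Qed.

End SubjectReduction.

Unset Implicit Arguments.

Theorem mainTheorem3 (S : eqType) (ob : S -> seq S) (ctl : S -> control)
    (eta eta' : nat) (P P' : proc S) (mu : action S)
    (heta : eta <= 1) (heta' : eta' <= 1)
    (hP : well_sorted ob P) :
  typed ctl eta P -> cstep ob ctl eta P mu eta' P' -> typed ctl eta' P'.
Proof.
move=> tP [[_ step ok] ->].
have := lts_residual_typed step hP tP.
case: mu step ok => [|a bs|cs a bs] _ //=; rewrite /icontrolled /ocontrolled;
  case: (ctl _) => // ok.
(* Being type-allowed forces [eta = 0] here: with [eta = 1] the subject of the input would be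
   input-controlled. *)
- by move=> h; case: ok => [/h|//|[_]].
- by case=> ->.
- by case.
Qed.
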